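(* Let $J$ be an index set and let $\{h_j:j\in J\}$ be a commuting family of functions $h_j:A\to A$ on a set $A$. Then there exists a quadruple $(B,i,(v_j)_{j\in J},p)$ where $B$ is a set, $i:A\to B$ is an injective map, $v_j:B\to B$, $j\in J$, is a commuting family of injective maps, and $p:B\to B$ is an idempotent ($p\circ p=p$), such that $$i(h_{j_1}h_{j_2}\cdots h_{j_k}(a))=p(v_{j_1}v_{j_2}\cdots v_{j_k}(i(a)))\quad\text{for all } k\in\mathbb{Z}_+,\ j_1,\ldots,j_k\in J,\ a\in A,$$ and $$B=\{v_{j_1}v_{j_2}\cdots v_{j_k}(i(a)): k\in\mathbb{Z}_+,\ j_1,\ldots,j_k\in J,\ a\in A\}.$$
   Context: $\mathbb{Z}_+=\{0,1,2,\ldots\}$. A family of self-maps is commuting if any two of its members commute under composition. Juxtaposition of functions denotes composition, and the empty composition ($k=0$) is the identity. *)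

(* Defs.v *)
From mathcomp Require Import all_boot.
Set Implicit Arguments.
Unset Strict Implicit.
Unset Printing Implicit Defensive.

Definition commuting_family (J T : Type) (f : J -> T -> T) : Prop :=
  forall j k : J, f j \o f k =1 f k \o f j.

(* f_{j_1} f_{j_2} ... f_{j_k} for js = [:: j_1; ...; j_k]: the last index acts
   first. *)
Definition comp_word (J T : Type) (f : J -> T -> T) (js : seq J) : T -> T :=
  foldr (fun j g => f j \o g) id js.

(* Main.v *)
Require Import Defs.
From mathcomp Require Import all_boot.
From mathcomp Require Import finmap multiset.
From mathcomp Require Import boolp.

(** The free commutative monoid on [J] carries the universal commuting family:
    translation by a generator.  Its elements are the finite multisets over
    [J], and it is cancellative, so these translations are injective whatever
    the maps [h j] are.  Therefore take [B] to be the product of this monoid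
    with [A], let [v j] add the generator [j] to the first component, and let
    [i] embed [A] over the empty multiset.  In [B] a word is only recorded, not
    evaluated: [(m, a)] stands for the unevaluated expression ``[h] along [m],
    applied to [a]''.  The idempotent [p] evaluates it, sending [(m, a)] to
    [i] of its value.  Evaluation along a multiset makes sense because the
    value of a word in commuting maps does not depend on the order of its
    letters ([comp_word_perm]); and a word in the [v j] started on [i a]
    records exactly the multiset of its letters ([comp_word_translate]), which
    gives both the dilation identity and the fact that words exhaust [B]. *)

Set Implicit Arguments.
Unset Strict Implicit.
Unset Printing Implicit Defensive.

Local Open Scope mset_scope.

Lemma comp_word_cat (J T : Type) (f : J -> T -> T) (s t : seq J) (x : T) :
  comp_word f (s ++ t) x = comp_word f s (comp_word f t x).
Proof. by elim: s => //= j s ->. Qed.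

Lemma comp_wordC (J T : Type) (f : J -> T -> T) (s t : seq J) (x : T) :
  commuting_family f ->
  comp_word f s (comp_word f t x) = comp_word f t (comp_word f s x).
Proof.
move=> fC.
have letterC j u y : f j (comp_word f u y) = comp_word f u (f j y).
  by elim: u => //= k u <-; apply: fC.
by elim: s => //= j s ->; rewrite letterC.
Qed.

(** Exchanging adjacent blocks generates all permutations of a word, so
    commutation of words is enough. *)
Lemma comp_word_perm (J : eqType) (T : Type) (f : J -> T -> T) (s t : seq J)
    (x : T) :
  commuting_family f -> perm_eq s t -> comp_word f s x = comp_word f t x.
Proof.
move=> fC; apply: (@catCA_perm_subst _ _ (fun u => comp_word f u x)) => u1 u2 u3.
by rewrite !comp_word_cat; apply: comp_wordC.
Qed.

Definition translate (J : choiceType) (A : Type) (j : J) (b : {mset J} * A) :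
    {mset J} * A := (j +` b.1, b.2).

Definition evaluate (J : choiceType) (A : Type) (h : J -> A -> A)
    (b : {mset J} * A) : {mset J} * A :=
  (mset0, comp_word h (enum_mset b.1) b.2).

Lemma translateC (J : choiceType) (A : Type) :
  commuting_family (@translate J A).
Proof. by move=> j k b; rewrite /translate /= msetDCA. Qed.

Lemma translate_inj (J : choiceType) (A : Type) (j : J) :
  injective (@translate J A j).
Proof.
by case=> [m a] [n b] [/(can_inj (msetDKB [mset j])) -> ->].
Qed.

Lemma comp_word_translate (J : choiceType) (A : Type) (js : seq J) (a : A) :
  comp_word (@translate J A) js (mset0, a) = (seq_mset js, a).
Proof.
elim: js => [|j js /= ->]; last by rewrite /translate mset_cons.
by rewrite -[mset0]seq_mset_id enum_mset0.
Qed.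

(** The case of a [choiceType] of indices, over which finite multisets can be
    formed. *)
Lemma commuting_dilation (J : choiceType) (A : Type) (h : J -> A -> A)
    (h_comm : commuting_family h) :
  exists (B : Type) (i : A -> B) (v : J -> B -> B) (p : B -> B),
    injective i /\
    commuting_family v /\
    (forall j : J, injective (v j)) /\
    idempotent_fun p /\
    (forall (js : seq J) (a : A),
       i (comp_word h js a) = p (comp_word v js (i a))) /\
    (forall b : B, exists (js : seq J) (a : A), b = comp_word v js (i a)).
Proof.
exists ({mset J} * A)%type, (pair mset0), (@translate J A), (evaluate h).
split; first by move=> a b [].
split; first exact: translateC.
split; first exact: translate_inj.
split; first by move=> b; rewrite /evaluate /= enum_mset0.
split=> [js a | [m a]].
  rewrite comp_word_translate /evaluate /=; congr (_, _).
  by apply: comp_word_perm => //; rewrite perm_sym perm_eq_seq_mset.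
by exists (enum_mset m), a; rewrite comp_word_translate seq_mset_id.
Qed.

Theorem theorem2p2 (J A : Type) (h : J -> A -> A)
    (h_comm : commuting_family h) :
  exists (B : Type) (i : A -> B) (v : J -> B -> B) (p : B -> B),
    injective i /\
    commuting_family v /\
    (forall j : J, injective (v j)) /\
    idempotent_fun p /\
    (forall (js : seq J) (a : A),
       i (comp_word h js a) = p (comp_word v js (i a))) /\
    (forall b : B, exists (js : seq J) (a : A), b = comp_word v js (i a)).
Proof.
(* Classical choice equips the bare type [J] with a [choiceType] structure. *)
exact: (@commuting_dilation {classic J}).
Qed.
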